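(* Let $\lambda\in\mathbb{R}^m_+$. The regime classification map $\Psi$ satisfies the following invariances. (i) (Permutation invariance.) For any permutation $\pi\in S_m$, $\Psi(\pi\cdot\lambda)=\Psi(\lambda)$, where $(\pi\cdot\lambda)_i=\lambda_{\pi(i)}$. (ii) (Uniform multiplier rescaling.) For any $c>0$, $\Sigma_k(c\lambda)=\Sigma_k(\lambda)$, $\sigma_\delta(c\lambda)=\sigma_\delta(\lambda)$ and $\tau(c\lambda)=\tau(\lambda)$. Consequently, if both $L(\lambda)$ and $L(c\lambda)=cL(\lambda)$ lie on the same side of $\delta$, then $\Psi(c\lambda)=\Psi(\lambda)$. (iii) (Uniform constraint rescaling.) Let $(x^\star,\lambda^\star,\mu^\star)$ be a KKT triple of problem (P) satisfying LICQ and SOSC. Suppose (P) is modified by replacing each $g_i$ with $c\,g_i$ for a single $c>0$. Then the modified problem has the same primal solution $x^\star$, and its inequality multipliers are $\lambda^\star_{\mathrm{new}}=\lambda^\star/c$. Hence $\Psi(\lambda^\star_{\mathrm{new}})=\Psi(\lambda^\star)$ whenever $L(\lambda^\star)/c$ and $L(\lambda^\star)$ lie on the same side of $\delta$. (iv) (Diffeomorphism invariance.) Let $\phi:U\to V$ be a $C^2$ diffeomorphism between open neighborhoods $U,V\subset\mathbb{R}^n$ (with $x^\star\in U$), and define the transformed problem by $\tilde f:=f\circ\phi^{-1}$, $\tilde g_i:=g_i\circ\phi^{-1}$, $\tilde h_j:=h_j\circ\phi^{-1}$. If $(x^\star,\lambda^\star,\mu^\star)$ is a KKT triple of (P) satisfying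 LICQ and SOSC, then $(\phi(x^\star),\lambda^\star,\mu^\star)$ is a KKT triple of the transformed problem satisfying LICQ and SOSC, and $\Psi$ assigns the same label.
   Context: Features. For $\lambda\in\mathbb{R}^m_+$ let $L(\lambda)=\|\lambda\|_1=\sum_i\lambda_i$; if $L(\lambda)>0$ let $\bar\lambda=\lambda/L(\lambda)$, and if $L(\lambda)=0$ let $\bar\lambda=0$. Let $\bar\lambda_{(1)}\ge\cdots\ge\bar\lambda_{(m)}$ be the sorted entries of $\bar\lambda$. Fix parameters $\Theta=(\delta,\theta,\gamma,k)$ with $0<\delta<\tfrac12$, $\theta\in(\tfrac12,1)$, $\gamma\in(0,1)$, $k\in\{1,\dots,m-1\}$. Define $\Sigma_k(\lambda)=\sum_{j=1}^k\bar\lambda_{(j)}$, $\sigma_\delta(\lambda)=\frac1m|\{i:\bar\lambda_i>\delta\}|$, $\tau(\lambda)=\bar\lambda_{(2)}$. Core regimes (subsets of $\mathbb{R}^m_+$): $\mathcal{R}_{\mathrm{unc}}^\circ=\{L<\delta\}$; $\mathcal{R}_{\mathrm{res}}^\circ=\{L>\delta,\ \Sigma_k>\theta\}$; $\mathcal{R}_{\mathrm{sat}}^\circ=\{L>\delta,\ \Sigma_k<\theta,\ \sigma_\delta>\gamma\}$; $\mathcal{R}_{\mathrm{coup}}^\circ=\{L>\delta,\ \Sigma_k<\theta,\ \sigma_\delta<\gamma,\ \tau>\delta\}$. The map $\Psi:\mathbb{R}^m_+\to\{\mathrm{unc},\mathrm{res},\mathrm{sat},\mathrm{coup},\mathrm{hyb}\}$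 assigns to $\lambda$ the unique label $r\in\{\mathrm{unc},\mathrm{res},\mathrm{sat},\mathrm{coup}\}$ with $\lambda\in\mathcal{R}_r^\circ$ if there is one, and $\mathrm{hyb}$ otherwise. Problem (P): minimize $f(x)$ over $x\in\mathbb{R}^n$ subject to $g_i(x)\le0$ ($i=1,\dots,m$), $h_j(x)=0$ ($j=1,\dots,p$), with $f,g_i,h_j$ of class $C^2$. Its Lagrangian is $\mathfrak{L}(x,\lambda,\mu)=f(x)+\sum_i\lambda_ig_i(x)+\sum_j\mu_jh_j(x)$. A KKT triple $(x^\star,\lambda^\star,\mu^\star)\in\mathbb{R}^n\times\mathbb{R}^m_+\times\mathbb{R}^p$ satisfies $\nabla_x\mathfrak{L}(x^\star,\lambda^\star,\mu^\star)=0$; $g_i(x^\star)\le0$, $\lambda_i^\star\ge0$, $\lambda_i^\star g_i(x^\star)=0$ for all $i$; $h_j(x^\star)=0$ for all $j$. The active set is $\mathcal{A}(x^\star)=\{i:g_i(x^\star)=0\}$. LICQ: the gradients $\{\nabla g_i(x^\star)\}_{i\in\mathcal{A}(x^\star)}\cup\{\nabla h_j(x^\star)\}_{j=1}^p$ are linearly independent. SOSC: $d^\top\nabla^2_{xx}\mathfrak{L}(x^\star,\lambda^\star,\mu^\star)d>0$ for every nonzero $d$ such that $\nabla g_i(x^\star)^\top d\le0$ for all $i\in\mathcal{A}(x^\star)$, $\nabla g_i(x^\star)^\top d=0$ for all $i$ with $\lambda_i^\star\ne0$, and $\nabla h_j(x^\star)^\top d=0$ for all $j$. *)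

(* Defs.v *)
(* MathComp and MathComp-Analysis *)
From HB Require Import structures.
From mathcomp Require Import all_boot all_order all_algebra all_fingroup.
From mathcomp Require Import all_classical all_reals all_analysis.
Set Implicit Arguments.
Unset Strict Implicit.
Unset Printing Implicit Defensive.
Import Order.TTheory GRing.Theory Num.Theory.
Import numFieldNormedType.Exports.

Local Open Scope classical_set_scope.
Local Open Scope ring_scope.

Section Regimes.
Context {R : realType} {m : nat}.
Implicit Types (lam : 'rV[R]_m) (delta theta gamma : R) (k : nat).

Definition nonneg lam : Prop := forall i, 0 <= lam 0 i.

(* The 1-norm, on the nonnegative orthant. *)
Definition load lam : R := \sum_(i < m) lam 0 i.

Definition normalized lam : 'rV[R]_m :=
  if 0 < load lam then (load lam)^-1 *: lam else 0.

Definition sorted_entries lam : seq R :=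
  sort (fun x y : R => y <= x) [seq lam 0 i | i : 'I_m].

(* The sorted list is 0-indexed: its entry of rank j is [nth 0 _ j.-1]. *)
Definition Sigma k lam : R :=
  \sum_(j < k) nth 0 (sorted_entries (normalized lam)) j.

Definition sigma delta lam : R :=
  #|[set i : 'I_m | delta < normalized lam 0 i]%SET|%:R / m%:R.

Definition tau lam : R := nth 0 (sorted_entries (normalized lam)) 1.

Inductive regime := Unc | Res | Sat | Coup | Hyb.

(* [Hyb] is not a core regime, hence its empty core. *)
Definition core delta theta gamma k (r : regime) : set 'rV[R]_m :=
  match r with
  | Unc => [set lam | nonneg lam /\ load lam < delta]
  | Res => [set lam | nonneg lam /\ (delta < load lam /\ theta < Sigma k lam)]
  | Sat => [set lam | nonneg lam /\
      [/\ delta < load lam, Sigma k lam < theta & gamma < sigma delta lam]]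
  | Coup => [set lam | nonneg lam /\
      [/\ delta < load lam, Sigma k lam < theta, sigma delta lam < gamma
        & delta < tau lam]]
  | Hyb => set0
  end.

Definition Psi delta theta gamma k lam : regime :=
  if pselect (exists! r, core delta theta gamma k r lam) is left e
  then sval (cid e) else Hyb.

Lemma core_unique delta theta gamma k r s lam :
  core delta theta gamma k r lam -> core delta theta gamma k s lam -> r = s.
Proof.
case: r; case: s => //= -[_ H1] [_ H2]; exfalso.
all: repeat match goal with
  | H : _ /\ _ |- _ => destruct H
  | H : [/\ _, _ & _] |- _ => destruct H
  | H : [/\ _, _, _ & _] |- _ => destruct H
  end.
all: match goal with
  | H : is_true (?a < ?b), H' : is_true (?b < ?a) |- _ =>
    by move: (lt_trans H H'); rewrite ltxx
  end.
Qed.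

Lemma PsiP delta theta gamma k r lam :
  core delta theta gamma k r lam -> Psi delta theta gamma k lam = r.
Proof.
move=> Hr; rewrite /Psi; case: pselect => [e|[]].
  by case: (cid e) => s /= [Hs _]; exact: core_unique Hs Hr.
by exists r; split=> // s; exact: core_unique.
Qed.

Definition same_side delta (a b : R) : Prop :=
  (a < delta /\ b < delta) \/ (delta < a /\ delta < b).

End Regimes.

Section Calculus.
Context {R : realType} {n : nat}.

Definition partial {W : normedModType R} (i : 'I_n) (f : 'rV[R]_n -> W) :
    'rV[R]_n -> W :=
  fun x => 'D_(delta_mx 0 i) f x.

Definition C1_on {W : normedModType R} (U : set 'rV[R]_n) (f : 'rV[R]_n -> W) :
    Prop :=
  forall x, U x ->
    differentiable f x /\ forall i, {for x, continuous (partial i f)}.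

Definition C2_on {W : normedModType R} (U : set 'rV[R]_n) (f : 'rV[R]_n -> W) :
    Prop :=
  C1_on U f /\ forall i, C1_on U (partial i f).

Definition gradient (f : 'rV[R]_n -> R) (x : 'rV[R]_n) : 'rV[R]_n :=
  \row_i partial i f x.

Definition hessian (f : 'rV[R]_n -> R) (x : 'rV[R]_n) : 'M[R]_n :=
  \matrix_(i, j) partial i (partial j f) x.

Definition dot (u v : 'rV[R]_n) : R := (u *m v^T) 0 0.

(* [psi] only matters on [V], where it is the inverse of [phi]. *)
Definition C2_diffeo (U V : set 'rV[R]_n) (phi psi : 'rV[R]_n -> 'rV[R]_n) :
    Prop :=
  [/\ open U /\ open V, set_bij U V phi, forall x, U x -> psi (phi x) = x,
      C2_on U phi & C2_on V psi].

End Calculus.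

(* The domain records where the data are meaningful: the functions are total,
   but their values outside of [dom] are irrelevant. *)
Record nlp (R : realType) (n m p : nat) := NLP {
  dom : set 'rV[R]_n;
  obj : 'rV[R]_n -> R;
  ineq : 'I_m -> 'rV[R]_n -> R;
  eqc : 'I_p -> 'rV[R]_n -> R
}.

Section NLP.
Context {R : realType} {n m p : nat}.
Implicit Types (P : nlp R n m p) (x : 'rV[R]_n).
Implicit Types (lam : 'rV[R]_m) (mu : 'rV[R]_p).

Definition C2_nlp P : Prop :=
  [/\ open (dom P), C2_on (dom P) (obj P),
      forall i, C2_on (dom P) (ineq P i) & forall j, C2_on (dom P) (eqc P j)].

Definition feasible P x : Prop :=
  [/\ dom P x, forall i, ineq P i x <= 0 & forall j, eqc P j x = 0].

Definition solution P x : Prop :=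
  feasible P x /\ forall y, feasible P y -> obj P x <= obj P y.

Definition local_solution P x : Prop :=
  feasible P x /\ \forall y \near x, feasible P y -> obj P x <= obj P y.

Definition lagrangian P lam mu x : R :=
  obj P x + \sum_(i < m) lam 0 i * ineq P i x + \sum_(j < p) mu 0 j * eqc P j x.

Definition kkt_triple P x lam mu : Prop :=
  [/\ gradient (lagrangian P lam mu) x = 0, feasible P x, nonneg lam
    & forall i, lam 0 i * ineq P i x = 0].

Definition active P x : {set 'I_m} := [set i | ineq P i x == 0]%SET.

Definition LICQ P x : Prop :=
  free ([seq gradient (ineq P i) x | i in active P x] ++
        [seq gradient (eqc P j) x | j : 'I_p]).

Definition SOSC P x lam mu : Prop :=
  forall d : 'rV[R]_n, d != 0 ->
    (forall i, i \in active P x -> dot (gradient (ineq P i) x) d <= 0) ->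
    (forall i, lam 0 i != 0 -> dot (gradient (ineq P i) x) d = 0) ->
    (forall j, dot (gradient (eqc P j) x) d = 0) ->
    0 < dot (d *m hessian (lagrangian P lam mu) x) d.

Definition scale_ineq (c : R) P : nlp R n m p :=
  NLP (dom P) (obj P) (fun i x => c * ineq P i x) (eqc P).

(* The problem transported to [V] by a diffeomorphism with inverse [psi]. *)
Definition transport (V : set 'rV[R]_n) (psi : 'rV[R]_n -> 'rV[R]_n) P :
    nlp R n m p :=
  NLP V (obj P \o psi) (fun i => ineq P i \o psi) (fun j => eqc P j \o psi).

End NLP.

(* Main.v *)
Require Import Defs.
From mathcomp Require Import all_boot all_order all_algebra all_fingroup.
From mathcomp Require Import all_classical all_reals all_analysis.
Import Order.TTheory GRing.Theory Num.Theory.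
Import numFieldNormedType.Exports.
Local Open Scope classical_set_scope.
Local Open Scope ring_scope.

Set Implicit Arguments.
Unset Strict Implicit.
Unset Printing Implicit Defensive.

(** The label of [lam] depends only on the position of the load relative to
    [delta] and on the entries of [normalized lam] as a multiset.  A permutation
    preserves both ([Psi_permute]); a positive factor leaves [normalized lam]
    unchanged, so that only the load can move the label ([Psi_scale]).

    Multiplying the inequality constraints by [c] is the same, for the
    Lagrangian, as multiplying their multipliers by [c]: KKT triples of the two
    problems correspond ([kkt_scale_ineq]), feasible sets and objectives agree,
    and LICQ makes the multipliers unique ([kkt_unique]).  That [x] is a local
    solution is the second-order sufficient condition ([SOSC_local_solution]).
    It is proved without sequences.  For each nonzero direction [d], no point
    [x + t *: d'] with [d'] near [d] and [t] small positive is both feasible and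
    better than [x]: either the derivative along [d] of the objective or of a
    constraint already excludes it, or [d] is critical and the Lagrangian, which
    bounds the objective from below on the feasible set, increases along all
    rays close to [d].  Compactness of the unit sphere makes the bound on [t]
    uniform in the direction.  The increase along rays uses only the mean value
    theorem, applied once to a function with positive slope, and twice, to the
    function and to its directional derivative, when the gradient vanishes and
    the curvature is positive.

    Under a change of variables with Jacobian [J], gradients at the
    corresponding points are multiplied by the transpose of [J]
    ([gradient_comp]), and the Hessian [H] of the Lagrangian becomes
    [J *m H *m J^T], because the term with the second derivatives of the change
    of variables is weighted by the gradient of the Lagrangian, which is zero at
    a KKT point ([hessian_comp]).  As [J] is invertible, stationarity, linear independence,
    and positivity on the critical cone are transported; the multipliers of the
    transported problem are then unique, so its label is that of [lam]. *)

(** * Regimes under permutation and rescaling *)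

Section Regime.
Context {R : realType} {m : nat}.
Implicit Types (lam : 'rV[R]_m) (delta theta gamma c : R) (k : nat).

(** [Psi] is a function of the predicate [fun r => core _ _ _ _ r lam] alone. *)
Lemma Psi_eq delta theta gamma k lam lam' :
  (forall r, core delta theta gamma k r lam = core delta theta gamma k r lam') ->
  Psi delta theta gamma k lam = Psi delta theta gamma k lam'.
Proof.
move=> E.
pose choose_label (C : regime -> Prop) :=
  if pselect (exists! r, C r) is left e then sval (cid e) else Hyb.
exact: (congr1 choose_label (funext E)).
Qed.

Definition permute (s : 'S_m) lam : 'rV[R]_m := \row_i lam 0 (s i).

Lemma load_permute s lam : load (permute s lam) = load lam.
Proof.
rewrite /load [RHS](reindex_inj (@perm_inj _ s)).
by apply: eq_bigr => i _; rewrite mxE.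
Qed.

Lemma nonneg_permute s lam : nonneg (permute s lam) <-> nonneg lam.
Proof.
split=> H i; last by rewrite mxE.
by have := H (s^-1%g i); rewrite mxE permKV.
Qed.

Lemma normalized_permute s lam :
  normalized (permute s lam) = permute s (normalized lam).
Proof.
rewrite /normalized load_permute; case: ifP => _;
  by apply/rowP => i; rewrite !mxE.
Qed.

Lemma sorted_entries_permute s lam :
  sorted_entries (permute s lam) = sorted_entries lam.
Proof.
apply/perm_sortP.
- by move=> x y; exact: le_total.
- by move=> y x z xy yz; exact: le_trans yz xy.
- by move=> x y xy; apply: le_anti; rewrite andbC.
have -> : [seq permute s lam 0 i | i : 'I_m]
    = [seq lam 0 i | i <- [seq s i | i : 'I_m]].
  by rewrite -map_comp; apply: eq_map => i /=; rewrite mxE.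
apply/perm_map/uniq_perm; rewrite ?enum_uniq//.
  by rewrite map_inj_uniq ?enum_uniq//; exact: perm_inj.
move=> i; rewrite mem_enum; apply/mapP; exists (s^-1%g i); rewrite ?permKV//.
by rewrite mem_enum.
Qed.

Lemma Sigma_permute k s lam : Sigma k (permute s lam) = Sigma k lam.
Proof. by rewrite /Sigma normalized_permute sorted_entries_permute. Qed.

Lemma tau_permute s lam : tau (permute s lam) = tau lam.
Proof. by rewrite /tau normalized_permute sorted_entries_permute. Qed.

Lemma sigma_permute delta s lam : sigma delta (permute s lam) = sigma delta lam.
Proof.
rewrite /sigma normalized_permute; congr (_%:R / _).
rewrite -(card_imset _ (@perm_inj _ s)); apply: eq_card => i.
apply/imsetP/idP => [[j + ->]|]; rewrite !inE ?mxE// => di.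
by exists (s^-1%g i); rewrite ?inE ?mxE permKV.
Qed.

Lemma Psi_permute delta theta gamma k s lam :
  Psi delta theta gamma k (permute s lam) = Psi delta theta gamma k lam.
Proof.
apply: Psi_eq => -[] //=; apply/propext; rewrite nonneg_permute load_permute;
  by rewrite ?Sigma_permute ?sigma_permute ?tau_permute.
Qed.

Lemma load_scale c lam : load (c *: lam) = c * load lam.
Proof. by rewrite /load mulr_sumr; apply: eq_bigr => i _; rewrite mxE. Qed.

Lemma nonneg_scale c lam : 0 < c -> nonneg (c *: lam) <-> nonneg lam.
Proof. by move=> c0; split=> H i; have := H i; rewrite mxE pmulr_rge0. Qed.

Lemma normalized_scale c lam : 0 < c -> normalized (c *: lam) = normalized lam.
Proof.
move=> c0; rewrite /normalized load_scale pmulr_rgt0//; case: ifP => // _.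
by rewrite scalerA invfM mulrAC mulVf ?mul1r// gt_eqF.
Qed.

Lemma Sigma_scale k c lam : 0 < c -> Sigma k (c *: lam) = Sigma k lam.
Proof. by move=> c0; rewrite /Sigma normalized_scale. Qed.

Lemma sigma_scale delta c lam : 0 < c -> sigma delta (c *: lam) = sigma delta lam.
Proof. by move=> c0; rewrite /sigma normalized_scale. Qed.

Lemma tau_scale c lam : 0 < c -> tau (c *: lam) = tau lam.
Proof. by move=> c0; rewrite /tau normalized_scale. Qed.

Lemma Psi_scale delta theta gamma k c lam : 0 < c ->
  same_side delta (load lam) (load (c *: lam)) ->
  Psi delta theta gamma k (c *: lam) = Psi delta theta gamma k lam.
Proof.
move=> c0 side.
have [lE gE] : ((load (c *: lam) < delta) = (load lam < delta)) /\
    ((delta < load (c *: lam)) = (delta < load lam)).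
  by case: side => -[a b]; rewrite a b ?(lt_gtF a) ?(lt_gtF b).
by apply: Psi_eq => -[] //=; apply/propext; rewrite nonneg_scale// ?lE ?gE
  ?Sigma_scale ?sigma_scale ?tau_scale.
Qed.

End Regime.

(** * Functions of class C1 and C2 *)

Lemma cvg_sumr {R : realType} (T I : Type) (F : set_system T) (FF : Filter F)
    (s : seq I) (f : I -> T -> R) (a : I -> R) :
  (forall i, f i t @[t --> F] --> a i) ->
  (\sum_(i <- s) f i t) @[t --> F] --> \sum_(i <- s) a i.
Proof.
move=> fa; apply: cvg_big => [|i _]; last exact: fa.
exact: (@add_continuous R).
Qed.

Section Partial.
Context {R : realType} {n : nat}.
Notation V := 'rV[R]_n.

(** Differentiability at a point is a local property: the expansion of [f]
    serves as an expansion of [g], which identifies the differential of [g]. *)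
Lemma near_eq_differentiable (W : normedModType R) (f g : V -> W) (x : V) :
  {near x, f =1 g} -> differentiable f x -> differentiable g x.
Proof.
move=> fg df.
have [dfc /eqaddoP dfo] := (diff_locallyP _ _).1 df.
have gx : g x = f x by rewrite (nbhs_singleton fg).
suff go : g \o shift x
    = cst (g x) + ('d f x : V -> W) +o_ (nbhs_filter_on (0 : V)) (@id V).
  by apply/diff_locallyP; rewrite (diff_unique dfc go).
apply/eqaddoP => e e0; move: (dfo e e0).
have : \forall h \near (0 : V), f (h + x) = g (h + x).
  by move: fg; rewrite (near_shift 0)/= subr0.
apply: filterS2 => h /= fgh; rewrite -![(_ - _) h]/(_ h - _ h) /=.
by rewrite -![(_ + _) h]/(_ h + _ h) /= fgh gx.
Qed.

Lemma open_near_eq (T : Type) (U : set V) (f g : V -> T) (x : V) :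
  open U -> {in U, f =1 g} -> U x -> {near x, f =1 g}.
Proof.
move=> oU fg Ux; have := open_nbhs_nbhs (conj oU Ux).
by apply: filterS => y Uy; exact/fg/mem_set.
Qed.

Lemma continuous_eq_on (T : topologicalType) (U : set V) (f g : V -> T) (x : V) :
  open U -> {in U, f =1 g} -> U x ->
  {for x, continuous f} -> {for x, continuous g}.
Proof.
move=> oU fg Ux; rewrite /prop_for /continuous_at -fg ?inE//.
exact: cvg_trans (near_eq_cvg (open_near_eq oU fg Ux)).
Qed.

Lemma derive_sum_partial (W : normedModType R) (f : V -> W) (x d : V) :
  differentiable f x -> 'D_d f x = \sum_i d 0 i *: partial i f x.
Proof.
move=> df; rewrite deriveE// {1}[d]row_sum_delta linear_sum/=.
by apply: eq_bigr => i _; rewrite linearZ/= /partial deriveE.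
Qed.

Lemma dotE (u v : V) : dot u v = \sum_i u 0 i * v 0 i.
Proof. by rewrite /dot mxE; apply: eq_bigr => i _; rewrite mxE. Qed.

Lemma derive_dot (f : V -> R) (x d : V) :
  differentiable f x -> 'D_d f x = dot (gradient f x) d.
Proof.
move=> df; rewrite derive_sum_partial// dotE; apply: eq_bigr => i _.
by rewrite /gradient mxE mulrC.
Qed.

End Partial.

Section C1.
Context {R : realType} {n : nat}.
Notation V := 'rV[R]_n.

Lemma partial_coord p (F : V -> 'rV[R]_p) (i : 'I_n) (k : 'I_p) x :
  differentiable F x -> partial i (fun y => F y 0 k) x = partial i F x 0 k.
Proof.
move=> dF; rewrite /partial derive_mx ?mxE//; exact: diff_derivable.
Qed.

Lemma partial_comp p (f : 'rV[R]_p -> R) (psi : V -> 'rV[R]_p) i y :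
  differentiable psi y -> differentiable f (psi y) ->
  partial i (f \o psi) y
  = \sum_k partial i psi y 0 k * partial k f (psi y).
Proof.
move=> dpsi df; rewrite {1}/partial deriveE; last exact: differentiable_comp.
by rewrite diff_comp//= -deriveE// -deriveE// (derive_sum_partial _ df).
Qed.

Lemma partialD (f g : V -> R) i y :
  differentiable f y -> differentiable g y ->
  partial i (f + g) y = partial i f y + partial i g y.
Proof.
by move=> df dg; rewrite /partial deriveD//; exact: diff_derivable.
Qed.

Lemma partialM (f g : V -> R) i y :
  differentiable f y -> differentiable g y ->
  partial i (f * g) y = f y * partial i g y + g y * partial i f y.
Proof.
by move=> df dg; rewrite /partial deriveM//; exact: diff_derivable.
Qed.

Lemma partial_cst (W : normedModType R) (c : W) i :
  partial i (cst c : V -> W) = cst 0.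
Proof. by apply/funext => y; rewrite /partial derive_cst. Qed.

Lemma partial_sum q (F : 'I_q -> V -> R) i y :
  (forall j, differentiable (F j) y) ->
  partial i (\sum_j F j) y = \sum_j partial i (F j) y.
Proof.
by move=> dF; rewrite /partial derive_sum// => j; exact: diff_derivable.
Qed.

Lemma partialZ (c : R) (f : V -> R) i y :
  differentiable f y -> partial i (cst c * f) y = c * partial i f y.
Proof. by move=> df; rewrite partialM// partial_cst mulr0 addr0. Qed.

Lemma differentiable_lincomb q (a : 'I_q -> R) (F : 'I_q -> V -> R) y :
  (forall j, differentiable (F j) y) ->
  differentiable (\sum_j cst (a j) * F j) y.
Proof.
by move=> dF; apply: differentiable_sum => j; exact: differentiableM.
Qed.

Lemma partial_lincomb q (a : 'I_q -> R) (F : 'I_q -> V -> R) i y :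
  (forall j, differentiable (F j) y) ->
  partial i (\sum_j cst (a j) * F j) y = \sum_j a j * partial i (F j) y.
Proof.
move=> dF; rewrite partial_sum => [|j]; last exact: differentiableM.
by apply: eq_bigr => j _; rewrite partialZ.
Qed.

(** The formulas for partial derivatives hold only on the open set where the
    functions are smooth; this lemma transfers smoothness from the right-hand
    sides of these formulas to the partial derivatives themselves. *)
Lemma C1_eq_on (W : normedModType R) (U : set V) (f g : V -> W) :
  open U -> {in U, f =1 g} -> C1_on U f -> C1_on U g.
Proof.
move=> oU fg Cf x Ux; have [df cf] := Cf x Ux.
split; first exact: near_eq_differentiable (open_near_eq oU fg Ux) df.
move=> i; apply: (continuous_eq_on oU _ Ux) (cf i).
by move=> y /set_mem Uy; apply: near_eq_derive; exact: open_near_eq oU fg Uy.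
Qed.

Lemma C1_coord p (U : set V) (F : V -> 'rV[R]_p) (k : 'I_p) :
  open U -> C1_on U F -> C1_on U (fun y => F y 0 k).
Proof.
move=> oU CF x Ux; have [dF cF] := CF x Ux; split.
  apply: (@differentiable_comp _ _ _ _ F (fun N : 'rV[R]_p => N 0 k)) => //.
  exact: differentiable_coord.
move=> i; apply: (@continuous_eq_on _ _ _ U (fun y => partial i F y 0 k)) => //.
  by move=> y /set_mem /CF[dFy _]; rewrite partial_coord.
apply: (@cvg_comp _ _ _ (partial i F) (fun N : 'rV_p => N 0 k)).
  exact: cF.
exact: coord_continuous.
Qed.

Lemma C1_comp p (U' : set 'rV[R]_p) (U : set V) (f : 'rV[R]_p -> R)
    (psi : V -> 'rV[R]_p) :
  open U -> (forall y, U y -> U' (psi y)) ->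
  C1_on U' f -> C1_on U psi -> C1_on U (f \o psi).
Proof.
move=> oU UU' Cf Cp x Ux; have [df cf] := Cf _ (UU' x Ux).
have [dp cp] := Cp x Ux.
split; first exact: differentiable_comp.
move=> i; apply: (@continuous_eq_on _ _ _ U
  (fun y => \sum_k partial i psi y 0 k * partial k f (psi y))) => //.
  move=> y /set_mem Uy; rewrite partial_comp//; first by have [] := Cp y Uy.
  by have [] := Cf _ (UU' y Uy).
apply: (@cvg_sumr R V _ (nbhs x)) => k; apply: cvgM.
  apply: (@cvg_comp _ _ _ (partial i psi) (fun N : 'rV_p => N 0 k)).
    exact: cp.
  exact: coord_continuous.
apply: continuous_comp; last exact: cf.
exact: differentiable_continuous.
Qed.

Lemma C1D (U : set V) (f g : V -> R) :
  open U -> C1_on U f -> C1_on U g -> C1_on U (f + g).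
Proof.
move=> oU Cf Cg x Ux; have [df cf] := Cf x Ux; have [dg cg] := Cg x Ux.
split; first exact: differentiableD.
move=> i; apply: (@continuous_eq_on _ _ _ U (partial i f + partial i g)) => //.
  by move=> y /set_mem Uy; rewrite partialD//;
    [have [] := Cf y Uy|have [] := Cg y Uy].
by apply: continuousD; [exact: cf|exact: cg].
Qed.

Lemma C1M (U : set V) (f g : V -> R) :
  open U -> C1_on U f -> C1_on U g -> C1_on U (f * g).
Proof.
move=> oU Cf Cg x Ux; have [df cf] := Cf x Ux; have [dg cg] := Cg x Ux.
split; first exact: differentiableM.
move=> i; apply: (@continuous_eq_on _ _ _ U
  (f * partial i g + g * partial i f)) => //.
  by move=> y /set_mem Uy; rewrite partialM//;
    [have [] := Cf y Uy|have [] := Cg y Uy].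
by apply: continuousD; apply: continuousM => //;
  exact: differentiable_continuous.
Qed.

Lemma C1_cst (U : set V) (c : R) : C1_on U (cst c).
Proof.
move=> x Ux; split; first exact: differentiable_cst.
by move=> i; rewrite partial_cst; exact: cst_continuous.
Qed.

Lemma C1_sum (I : Type) (s : seq I) (U : set V) (f : I -> V -> R) :
  open U -> (forall i, C1_on U (f i)) -> C1_on U (\sum_(i <- s) f i).
Proof.
move=> oU Cf; apply: (big_ind (C1_on U)) => [|g h|i _].
- have -> : (0 : V -> R) = cst 0 by [].
  exact: C1_cst.
- exact: C1D.
- exact: Cf.
Qed.

Lemma C2D (U : set V) (f g : V -> R) :
  open U -> C2_on U f -> C2_on U g -> C2_on U (f + g).
Proof.
move=> oU [Cf Cpf] [Cg Cpg]; split; first exact: C1D.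
move=> i; apply: (@C1_eq_on R U (partial i f + partial i g)) => [//||].
  by move=> y /set_mem Uy; rewrite partialD//;
    [have [] := Cf y Uy|have [] := Cg y Uy].
exact: C1D oU (Cpf i) (Cpg i).
Qed.

Lemma C2M (U : set V) (f g : V -> R) :
  open U -> C2_on U f -> C2_on U g -> C2_on U (f * g).
Proof.
move=> oU [Cf Cpf] [Cg Cpg]; split; first exact: C1M.
move=> i; apply: (@C1_eq_on R U (f * partial i g + g * partial i f)) => [//||].
  by move=> y /set_mem Uy; rewrite partialM//;
    [have [] := Cf y Uy|have [] := Cg y Uy].
exact: C1D oU (C1M oU Cf (Cpg i)) (C1M oU Cg (Cpf i)).
Qed.

Lemma C2_cst (U : set V) (c : R) : C2_on U (cst c).
Proof.
split; first exact: C1_cst.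
by move=> i; rewrite partial_cst; exact: C1_cst.
Qed.

Lemma C2_sum (I : Type) (s : seq I) (U : set V) (f : I -> V -> R) :
  open U -> (forall i, C2_on U (f i)) -> C2_on U (\sum_(i <- s) f i).
Proof.
move=> oU Cf; apply: (big_ind (C2_on U)) => [|g h|i _].
- have -> : (0 : V -> R) = cst 0 by [].
  exact: C2_cst.
- exact: C2D.
- exact: Cf.
Qed.

(** By the chain rule, the partial derivatives of [f \o psi] are sums of products
    of C1 functions. *)
Lemma C2_comp p (U' : set 'rV[R]_p) (U : set V) (f : 'rV[R]_p -> R)
    (psi : V -> 'rV[R]_p) :
  open U -> (forall y, U y -> U' (psi y)) ->
  C2_on U' f -> C2_on U psi -> C2_on U (f \o psi).
Proof.
move=> oU UU' [Cf Cpf] [Cp Cpp]; split; first exact: C1_comp oU UU' Cf Cp.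
move=> i; apply: (@C1_eq_on R U (\sum_k
    (fun y => partial i psi y 0 k) * (partial k f \o psi))) => [//||].
  move=> y /set_mem Uy; rewrite fct_sumE partial_comp//.
    by have [] := Cp y Uy.
  by have [] := Cf _ (UU' y Uy).
apply: (C1_sum _ oU) => k; apply: (C1M oU).
  exact: C1_coord oU (Cpp i).
exact: C1_comp oU UU' (Cpf k) Cp.
Qed.

End C1.

(** * The Lagrangian and uniqueness of multipliers *)

Section Free.
Context {K : fieldType} {vT : vectType K}.

(** [freeP] for a family indexed by an arbitrary list instead of by ordinals. *)
Lemma free_map_coef (I : eqType) (s : seq I) (w : I -> vT) (a : I -> K) :
  uniq s -> free (map w s) -> \sum_(i <- s) a i *: w i = 0 ->
  {in s, forall i, a i = 0}.
Proof.
elim: s => // i s IH /= /andP[_ us]; rewrite free_cons => /andP[wi fs].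
rewrite big_cons => S0.
have ai : a i = 0.
  apply: contraNeq wi => ai0.
  have -> : w i = (a i)^-1 *: - \sum_(j <- s) a j *: w j.
    move/eqP: S0; rewrite addr_eq0 => /eqP <-.
    by rewrite scalerA mulVf// scale1r.
  rewrite memvZ// memvN big_seq memv_suml// => j js.
  by rewrite memvZ// memv_span// map_f.
move: S0; rewrite ai scale0r add0r => S0 j.
by rewrite inE => /predU1P[->//|]; exact: IH.
Qed.

Lemma free_lker0 (vT' : vectType K) (f : 'Hom(vT, vT')) (X : seq vT) :
  lker f == 0%VS -> free X -> free (map f X).
Proof.
move=> /eqP kf fX.
have : basis_of <<X>> X by rewrite basisEfree fX subvv/= (eqnP fX).
by move=> /(limg_basis_of (f := f)); rewrite kf capv0 => /(_ erefl)/basis_free.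
Qed.

End Free.

Section Lagrangian.
Context {R : realType} {n m p : nat}.
Implicit Types (P : nlp R n m p) (x : 'rV[R]_n).
Implicit Types (lam : 'rV[R]_m) (mu : 'rV[R]_p).

(** A pointfree form, to which the closure properties of smooth functions
    apply. *)
Lemma lagrangian_sum P lam mu :
  lagrangian P lam mu = obj P + \sum_i cst (lam 0 i) * ineq P i
                        + \sum_j cst (mu 0 j) * eqc P j.
Proof. by apply/funext => x; rewrite /lagrangian !fct_sumE. Qed.

Lemma C2_lagrangian P lam mu :
  C2_nlp P -> C2_on (Defs.dom P) (lagrangian P lam mu).
Proof.
move=> [oD Cf Cg Ch]; rewrite lagrangian_sum.
have Clin q (c : 'I_q -> R) (F : 'I_q -> 'rV[R]_n -> R) :
    (forall i, C2_on (Defs.dom P) (F i)) ->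
    C2_on (Defs.dom P) (\sum_i cst (c i) * F i).
  move=> CF; apply: (C2_sum _ oD) => i; exact: (C2M oD (C2_cst _ _) (CF i)).
exact: (C2D oD (C2D oD Cf (Clin _ _ _ Cg)) (Clin _ _ _ Ch)).
Qed.

Lemma gradient_lagrangian P lam mu x : C2_nlp P -> Defs.dom P x ->
  gradient (lagrangian P lam mu) x = gradient (obj P) x
    + \sum_i lam 0 i *: gradient (ineq P i) x
    + \sum_j mu 0 j *: gradient (eqc P j) x.
Proof.
move=> [oD Cf Cg Ch] Dx.
have df : differentiable (obj P) x by have [/(_ x Dx)[]] := Cf.
have dg i : differentiable (ineq P i) x by have [/(_ x Dx)[]] := Cg i.
have dh j : differentiable (eqc P j) x by have [/(_ x Dx)[]] := Ch j.
have dlg := differentiable_lincomb (fun i => lam 0 i) dg.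
have dlh := differentiable_lincomb (fun j => mu 0 j) dh.
apply/rowP => k; rewrite lagrangian_sum !mxE !summxE.
rewrite partialD//; last exact: differentiableD.
rewrite partialD// !partial_lincomb//.
by congr (_ + _ + _); apply: eq_bigr => i _; rewrite !mxE.
Qed.

Lemma LICQ_coef P x (a : 'I_m -> R) (b : 'I_p -> R) :
  LICQ P x -> (forall i, i \notin active P x -> a i = 0) ->
  \sum_i a i *: gradient (ineq P i) x + \sum_j b j *: gradient (eqc P j) x = 0 ->
  forall i, a i = 0.
Proof.
move=> licq a0 S0 i.
have [ai|/a0//] := boolP (i \in active P x).
(* The sum type indexes both families of gradients at once. *)
pose w (k : 'I_m + 'I_p) := match k with
  inl i => gradient (ineq P i) x | inr j => gradient (eqc P j) x end.
pose c (k : 'I_m + 'I_p) := match k with inl i => a i | inr j => b j end.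
pose s := map inl (enum (active P x)) ++ map inr (enum 'I_p) : seq ('I_m + 'I_p).
suff: c (inl i) = 0 by [].
apply: (@free_map_coef _ _ _ s w c).
- rewrite cat_uniq !map_inj_uniq ?enum_uniq//= ?andbT//; try by move=> ? ? [].
  rewrite -enumT enum_uniq andbT.
  by apply/hasPn => k /mapP[j _ ->]; apply/mapP => -[].
- rewrite map_cat -!(map_comp w); exact: licq.
- rewrite big_cat !big_map -[RHS]S0; congr (_ + _).
  rewrite big_enum big_mkcond/=; apply: eq_bigr => k _.
  by case: ifP => // /negbT/a0 ->; rewrite scale0r.
- by rewrite mem_cat map_f// mem_enum.
Qed.

Lemma kkt_inactive P x lam mu i :
  kkt_triple P x lam mu -> i \notin active P x -> lam 0 i = 0.
Proof.
move=> [_ _ _ /(_ i)/eqP]; rewrite mulf_eq0 inE => /orP[/eqP//|->//].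
Qed.

(** The difference of two multiplier vectors is supported on the active set, by
    complementary slackness, and annihilates the active gradients, by
    stationarity. *)
Lemma kkt_unique P x lam mu lam' mu' : C2_nlp P -> LICQ P x ->
  kkt_triple P x lam mu -> kkt_triple P x lam' mu' -> lam = lam'.
Proof.
move=> CP licq kkt kkt'.
have [gL [Dx _ _] _ _] := kkt; have [gL' _ _ _] := kkt'.
apply/rowP => i; apply/eqP; rewrite -subr_eq0; apply/eqP; move: i.
apply: (@LICQ_coef P x _ (fun j => mu 0 j - mu' 0 j)) => // [i ia|].
  by rewrite (kkt_inactive kkt ia) (kkt_inactive kkt' ia) subrr.
move: gL gL'; rewrite !gradient_lagrangian// => gL gL'.
under eq_bigr do rewrite scalerBl.
under [X in _ + X]eq_bigr do rewrite scalerBl.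
rewrite !sumrB addrACA -opprD.
apply/eqP; rewrite subr_eq0; apply/eqP/(addrI (gradient (obj P) x)).
by rewrite !addrA gL gL'.
Qed.

End Lagrangian.

(** * Increase along rays *)

Section Ray.
Context {R : realType} {n : nat}.
Notation V := 'rV[R]_n.

(** The mean value theorem for [s |-> F (x + s *: d)]. *)
Lemma gt_ray (F : V -> R) (x d : V) (t : R) :
  (forall y, differentiable F y) -> 0 < t ->
  (forall s, 0 < s < t -> 0 < dot (gradient F (x + s *: d)) d) ->
  F x < F (x + t *: d).
Proof.
move=> dF t0 pos.
pose phi (s : R) := F (s *: d + x).
have dphi (s : R) : is_derive s (1 : R) phi (dot (gradient F (x + s *: d)) d).
  have dp : differentiable phi s.
    exact: (@differentiable_comp _ _ _ _ (fun s : R => s *: d + x) F).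
  apply: DeriveDef; first exact: diff_derivable.
  rewrite -derive_dot// addrC /derive.
  have -> : (fun h : R => h^-1 *: ((phi \o shift s) (h *: (1 : R)) - phi s))
    = (fun h : R => h^-1 *: ((F \o shift (s *: d + x)) (h *: d)
        - F (s *: d + x))); last by [].
  apply/funext => h; rewrite /= /phi.
  by rewrite -[h%:A]/(h * 1) mulr1 scalerDl addrA.
have [s st E] := @MVT R phi _ 0 t t0 (fun s _ => dphi s) (continuous_subspaceT
  (fun s => differentiable_continuous
     ((derivable1_diffP _ _).1 (@ex_derive _ _ _ _ _ _ _ (dphi s))))).
rewrite -subr_gt0; have -> : F (x + t *: d) - F x = phi t - phi 0.
  by rewrite /phi scale0r add0r [x + _]addrC.
by rewrite E subr0 mulr_gt0// pos// -in_itv.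
Qed.

(** A condition that holds near [(d, 0)] holds along a whole initial segment of
    each ray, which is the form in which the mean value theorem needs it. *)
Lemma near_ray (d : V) (Q : V -> R -> Prop) :
  (\forall z \near (d, 0 : R), Q z.1 z.2) ->
  \forall d' \near d & t \near (0:R)^'+, 0 < t /\ forall s, 0 < s < t -> Q d' s.
Proof.
move=> [[A B] [/= Ad /nbhs_ballP[e /= e0 eB]] sub].
exists (A, [set t | 0 < t < e]).
  split; first exact: Ad.
  by apply: filterS2 (nbhs_right_gt 0) (nbhs_right_lt e0) => t /= -> ->.
move=> [d' t] /= [Ad' /andP[t0 te]]; split=> // s /andP[s0 st].
apply: (sub (d', s)); split => //=; apply: eB.
by rewrite /ball/= sub0r normrN gtr0_norm// (lt_trans st).
Qed.

Lemma cvg_ray (d x : V) : (x + z.2 *: z.1) @[z --> (d, 0 : R)] --> x.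
Proof.
rewrite -[X in _ --> X]addr0 -(scale0r d); apply: cvgD; first exact: cvg_cst.
apply: cvgZ; [exact: cvg_snd|exact: cvg_fst].
Qed.

Lemma cvg_coord p (T : Type) (F : set_system T) (FF : Filter F)
    (f : T -> 'rV[R]_p) (l : 'rV[R]_p) (k : 'I_p) :
  f @ F --> l -> (f t 0 k) @[t --> F] --> l 0 k.
Proof.
move=> fl; apply: (@cvg_comp _ _ _ f (fun N : 'rV_p => N 0 k)) fl _.
exact: coord_continuous.
Qed.

Lemma cvg_dot (T : Type) (F : set_system T) (FF : Filter F)
    (u v : T -> V) (a b : V) :
  (forall k, u t 0 k @[t --> F] --> a 0 k) ->
  (forall k, v t 0 k @[t --> F] --> b 0 k) ->
  dot (u t) (v t) @[t --> F] --> dot a b.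
Proof.
move=> ua vb; rewrite dotE.
rewrite (_ : (fun t => _) = fun t => \sum_i u t 0 i * v t 0 i); last first.
  by apply/funext => t; rewrite dotE.
by apply: cvg_sumr => i; apply: cvgM; [exact: ua|exact: vb].
Qed.

(** Only column [j] of the matrices matters; [E] and [e] list its entries. *)
Lemma cvg_mulmx_row (T : Type) (F : set_system T) (FF : Filter F)
    (u : T -> V) (A : T -> 'M[R]_n) (E : T -> 'I_n -> R) (a : V) (e : 'I_n -> R)
    (B : 'M[R]_n) j :
  (forall t i, A t i j = E t i) -> (forall i, B i j = e i) ->
  (forall i, u t 0 i @[t --> F] --> a 0 i) ->
  (forall i, E t i @[t --> F] --> e i) ->
  (u t *m A t) 0 j @[t --> F] --> (a *m B) 0 j.
Proof.
move=> AE Be ua Ee; have -> : (a *m B) 0 j = \sum_i a 0 i * e i.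
  by rewrite mxE; apply: eq_bigr => i _; rewrite Be.
rewrite (_ : (fun t => _) = fun t => \sum_i u t 0 i * E t i); last first.
  by apply/funext => t; rewrite mxE; apply: eq_bigr => i _; rewrite AE.
by apply: cvg_sumr => i; apply: cvgM; [exact: ua|exact: Ee].
Qed.

Lemma near_ray_gt_slope (F : V -> R) (x d : V) :
  C1_on setT F -> 0 < dot (gradient F x) d ->
  \forall d' \near d & t \near (0:R)^'+, F x < F (x + t *: d').
Proof.
move=> CF pos.
have cvg_slope : dot (gradient F (x + z.2 *: z.1)) z.1 @[z --> (d, 0 : R)]
    --> dot (gradient F x) d.
  apply: (@cvg_dot _ (nbhs (d, 0 : R))) => k; last first.
    by apply: cvg_coord; exact: cvg_fst.
  rewrite mxE; under eq_fun do rewrite mxE.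
  apply: (@cvg_comp _ _ _ (fun z : V * R => x + z.2 *: z.1) (partial k F)).
    exact: cvg_ray.
  by have [_ /(_ k)] := CF x I.
have : \forall z \near (d, 0 : R), 0 < dot (gradient F (x + z.2 *: z.1)) z.1.
  exact: cvgr_gt cvg_slope _ pos.
move=> /(@near_ray d (fun d s => 0 < dot (gradient F (x + s *: d)) d)).
apply: filterS => -[d' t] /= [t0 H].
exact: (gt_ray (fun y => (CF y I).1) t0 H).
Qed.

(** With [d'] fixed, the directional derivative [G] of [F] along [d'] vanishes
    at [x] and its own derivative along [d'] is the quadratic form of the Hessian.
    So [G] is positive on the ray, and hence [F] increases: two applications
    of the mean value theorem replace the second-order Taylor expansion. *)
Lemma near_ray_gt_curvature (F : V -> R) (x d : V) :
  C2_on setT F -> gradient F x = 0 -> 0 < dot (d *m hessian F x) d ->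
  \forall d' \near d & t \near (0:R)^'+, F x < F (x + t *: d').
Proof.
move=> [CF CpF] gF pos.
have cvg_curv : dot (z.1 *m hessian F (x + z.2 *: z.1)) z.1
    @[z --> (d, 0 : R)] --> dot (d *m hessian F x) d.
  apply: (@cvg_dot _ (nbhs (d, 0 : R))) => j; last first.
    by apply: cvg_coord; exact: cvg_fst.
  apply: (@cvg_mulmx_row _ (nbhs (d, 0 : R)) _ _ _
    (fun z i => partial i (partial j F) (x + z.2 *: z.1)) _
    (fun i => partial i (partial j F) x)) => [z i|i|i|i].
  - by rewrite mxE.
  - by rewrite mxE.
  - by apply: cvg_coord; exact: cvg_fst.
  apply: (@cvg_comp _ _ _ (fun z : V * R => x + z.2 *: z.1)
    (partial i (partial j F))).
    exact: cvg_ray.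
  by have [_ /(_ i)] := CpF j x I.
have : \forall z \near (d, 0 : R),
    0 < dot (z.1 *m hessian F (x + z.2 *: z.1)) z.1.
  exact: cvgr_gt cvg_curv _ pos.
move=> /(@near_ray d (fun d s => 0 < dot (d *m hessian F (x + s *: d)) d)).
apply: filterS => -[d' t] /= [t0 H].
apply: (gt_ray (fun y => (CF y I).1) t0) => s /andP[s0 st].
pose G := \sum_j cst (d' 0 j) * partial j F.
have GE y : dot (gradient F y) d' = G y.
  by rewrite dotE /G fct_sumE; apply: eq_bigr => j _; rewrite mxE mulrC.
have dpF j y : differentiable (partial j F) y by have [] := CpF j y I.
have gG y : dot (gradient G y) d' = dot (d' *m hessian F y) d'.
  rewrite !dotE; under [RHS]eq_bigr do rewrite mxE mulr_suml.
  rewrite exchange_big/=; apply: eq_bigr => i _.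
  rewrite mxE partial_lincomb// mulr_suml; apply: eq_bigr => j _.
  by rewrite mxE mulrC mulrA mulrAC.
rewrite GE; have <- : G x = 0.
  by rewrite -GE gF dotE big1// => i _; rewrite mxE mul0r.
apply: gt_ray => // [y|r /andP[r0 rs]]; first exact: differentiable_lincomb.
by rewrite gG H// r0 (lt_trans rs).
Qed.

End Ray.

(** * Second-order sufficiency *)

Section Dot.
Context {R : realType} {n : nat}.
Implicit Types u v d : 'rV[R]_n.

Lemma dotDl u v d : dot (u + v) d = dot u d + dot v d.
Proof. by rewrite /dot mulmxDl mxE. Qed.

Lemma dotZl c u d : dot (c *: u) d = c * dot u d.
Proof. by rewrite /dot -scalemxAl mxE. Qed.

Lemma dot_suml (I : finType) (u : I -> 'rV[R]_n) d :
  dot (\sum_i u i) d = \sum_i dot (u i) d.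
Proof. by rewrite /dot mulmx_suml summxE. Qed.

End Dot.

Section SecondOrder.
Context {R : realType} {n m p : nat}.
Implicit Types (P : nlp R n m p) (x : 'rV[R]_n).
Implicit Types (lam : 'rV[R]_m) (mu : 'rV[R]_p).

Lemma sphere_compact : compact [set d : 'rV[R]_n | `|d| = 1].
Proof.
apply: bounded_closed_compact.
  exists 1; split; first exact: num_real.
  by move=> M M1 d /= ->; exact: ltW.
apply: (@preimage_closed _ _ (fun d : 'rV[R]_n => `|d|) [set 1]).
  by move=> d _; exact: norm_continuous.
exact: (@closed_eq R 1).
Qed.

(** The terms of [dot (gradient (lagrangian P lam mu) x) d = 0] are all
    nonpositive, so each of them is zero. *)
Lemma critical_direction P x lam mu d : C2_nlp P -> kkt_triple P x lam mu ->
  dot (gradient (obj P) x) d <= 0 ->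
  (forall i, i \in active P x -> dot (gradient (ineq P i) x) d <= 0) ->
  (forall j, dot (gradient (eqc P j) x) d = 0) ->
  forall i, lam 0 i != 0 -> dot (gradient (ineq P i) x) d = 0.
Proof.
move=> CP kkt df dg dh.
have [gL [Dx _ _] lam0 _] := kkt.
pose c i := lam 0 i * dot (gradient (ineq P i) x) d.
have c0 i : c i <= 0.
  have [ia|ia] := boolP (i \in active P x).
    by rewrite mulr_ge0_le0// dg.
  by rewrite /c (kkt_inactive kkt ia) mul0r.
have S0 : dot (gradient (obj P) x) d + \sum_i c i = 0.
  move: (congr1 (dot^~ d) gL); rewrite gradient_lagrangian// !dotDl !dot_suml.
  under eq_bigr do rewrite dotZl.
  under [X in _ + X]eq_bigr do rewrite dotZl dh mulr0.
  by rewrite sumr_const mul0rn addr0 => ->; rewrite /dot mul0mx mxE.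
have : \sum_i - c i == 0.
  rewrite eq_le sumrN oppr_le0 oppr_ge0 sumr_le0 ?andbT//.
  by move: S0 => /eqP; rewrite addr_eq0 => /eqP; rewrite -oppr_le0 => <-.
rewrite psumr_eq0 => [/allP c00 i li|i _]; last by rewrite oppr_ge0.
have := c00 i (mem_index_enum i); rewrite /= oppr_eq0 mulf_eq0 (negPf li)/=.
by move/eqP.
Qed.

(** The Lagrangian minorizes the objective on the feasible set and agrees with
    it at a KKT point ([lagrangian_kkt]), so a feasible point where the Lagrangian
    exceeds its value at [x] cannot improve the objective. *)
Lemma lagrangian_le P lam mu x :
  nonneg lam -> feasible P x -> lagrangian P lam mu x <= obj P x.
Proof.
move=> lam0 [_ gx hx]; rewrite /lagrangian.
rewrite [X in _ + X]big1 => [|j _]; last by rewrite hx mulr0.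
by rewrite addr0 gerDl sumr_le0// => i _; rewrite mulr_ge0_le0.
Qed.

Lemma lagrangian_kkt P lam mu x :
  kkt_triple P x lam mu -> lagrangian P lam mu x = obj P x.
Proof.
move=> [_ [_ _ hx] _ slack]; rewrite /lagrangian.
rewrite [X in _ + X]big1 => [|j _]; last by rewrite hx mulr0.
by rewrite big1 ?addr0.
Qed.

(** The local statement behind second-order sufficiency. The neighborhood of
    [d] matters: it is what allows a covering of the sphere by finitely many
    directions. *)
Lemma improving_direction_near P x lam mu (d : 'rV[R]_n) :
  Defs.dom P = setT -> C2_nlp P -> kkt_triple P x lam mu -> SOSC P x lam mu ->
  d != 0 ->
  \forall d' \near d & t \near (0:R)^'+,
    ~ (feasible P (x + t *: d') /\ obj P (x + t *: d') < obj P x).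
Proof.
move=> DT CP kkt sosc d0.
have [_ Cf Cg Ch] := CP; have CL := C2_lagrangian lam mu CP.
rewrite DT in Cf Cg Ch CL.
have [gL [_ gx hx] lam0 slack] := kkt.
have [[i [ia gi]]|/forallNP ng] :=
    pselect (exists i, i \in active P x /\ 0 < dot (gradient (ineq P i) x) d).
  apply: filterS (near_ray_gt_slope (Cg i).1 gi).
  move=> -[d' t] /= lt_g [[_ /(_ i) + _] _].
  by move: ia; rewrite inE => /eqP <-; rewrite leNgt lt_g.
have [[j hj]|/forallNP nh] :=
    pselect (exists j, dot (gradient (eqc P j) x) d != 0).
  (* Scaling by the slope itself makes the sign of the slope positive. *)
  have [c cj] : exists c, 0 < c * dot (gradient (eqc P j) x) d.
    by exists (dot (gradient (eqc P j) x) d); rewrite -expr2 exprn_even_gt0.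
  have Cc : C1_on setT (cst c * eqc P j).
    by apply: (C1M openT); [exact: C1_cst|exact: (Ch j).1].
  have : 0 < dot (gradient (cst c * eqc P j) x) d.
    suff -> : gradient (cst c * eqc P j) x = c *: gradient (eqc P j) x.
      by rewrite dotZl.
    apply/rowP => k; rewrite !mxE partialZ//.
    by have [/(_ x I)[]] := Ch j.
  move=> /(near_ray_gt_slope Cc); apply: filterS => -[d' t] /= + [[_ _ hy] _].
  by rewrite -[(_ * _) x]/(c * eqc P j x) -[(_ * _) _]/(c * eqc P j _) hx hy ltxx.
have [fd|fd] := ltP 0 (dot (gradient (obj P) x) d).
  apply: filterS (near_ray_gt_slope Cf.1 fd) => -[d' t] /= lt_f [_].
  by rewrite lt_gtF.
have dg i : i \in active P x -> dot (gradient (ineq P i) x) d <= 0.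
  by move=> ia; rewrite leNgt; apply/negP => gi; apply: (ng i).
have dh j : dot (gradient (eqc P j) x) d = 0.
  by apply/eqP; apply: contrapT => /negP; exact: nh.
have := sosc d d0 dg (critical_direction CP kkt fd dg dh) dh.
move=> /(near_ray_gt_curvature CL gL); apply: filterS => -[d' t] /= + [fy lt_f].
rewrite (lagrangian_kkt kkt) ltNge => /negP; apply.
exact: le_trans (lagrangian_le mu lam0 fy) (ltW lt_f).
Qed.

Lemma SOSC_local_solution P x lam mu :
  Defs.dom P = setT -> C2_nlp P -> kkt_triple P x lam mu -> SOSC P x lam mu ->
  local_solution P x.
Proof.
move=> DT CP kkt sosc; split; first by have [] := kkt.
pose improves (t : R) (d : 'rV[R]_n) :=
  feasible P (x + t *: d) /\ obj P (x + t *: d) < obj P x.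
(* A cover of the sphere by the neighborhoods of the directions gives a common
   bound on [t]. *)
have : \forall t \near (0:R)^'+, [set d : 'rV[R]_n | `|d| = 1] `<=`
    [set d | ~ improves t d].
  apply: ((compact_near_coveringP _).1 sphere_compact _ _
    (fun t d => ~ improves t d)) => d /= d1.
  apply: (improving_direction_near DT CP kkt sosc).
  by rewrite -normr_eq0 d1 oner_eq0.
move=> /nbhs_ballP[e /= e0 ball_e].
apply/nbhs_ballP; exists e => //= y xy fy.
have [->//|yx] := eqVneq y x.
have t0 : 0 < `|y - x| by rewrite normr_gt0 subr_eq0.
have ty : x + `|y - x| *: (`|y - x|^-1 *: (y - x)) = y.
  by rewrite scalerA mulfV ?gt_eqF// scale1r addrC subrK.
have te : ball 0 e `|y - x|.
  by move: xy; rewrite -!ball_normE/= sub0r normrN normr_id distrC.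
rewrite leNgt; apply/negP => lt_f.
apply: (ball_e _ te t0 (`|y - x|^-1 *: (y - x))) => /=; last first.
  by rewrite /improves ty.
by rewrite normrZ normfV normr_id mulVf// gt_eqF.
Qed.

End SecondOrder.

(** * Rescaling of the constraints, change of variables *)

Section Scaling.
Context {R : realType} {n m p : nat}.
Implicit Types (P : nlp R n m p) (x : 'rV[R]_n) (c : R).
Implicit Types (lam : 'rV[R]_m) (mu : 'rV[R]_p).

Lemma feasible_scale_ineq c P x : 0 < c ->
  feasible (scale_ineq c P) x <-> feasible P x.
Proof.
by move=> c0; split=> -[? gx ?]; split=> // i; have := gx i; rewrite /= pmulr_rle0.
Qed.

Lemma lagrangian_scale_ineq c P lam mu :
  lagrangian (scale_ineq c P) lam mu = lagrangian P (c *: lam) mu.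
Proof.
apply/funext => x; rewrite /lagrangian/=; congr (_ + _ + _).
by apply: eq_bigr => i _; rewrite mxE mulrA [_ * c]mulrC.
Qed.

Lemma kkt_scale_ineq c P x lam mu : 0 < c ->
  kkt_triple (scale_ineq c P) x lam mu <-> kkt_triple P x (c *: lam) mu.
Proof.
move=> c0; rewrite /kkt_triple lagrangian_scale_ineq.
have slackE : (forall i, lam 0 i * ineq (scale_ineq c P) i x = 0) <->
    (forall i, (c *: lam) 0 i * ineq P i x = 0).
  by split=> H i; have := H i; rewrite /= mxE mulrA [c * _]mulrC.
split=> -[gL fx lam0 slack]; split=> //.
- exact/(feasible_scale_ineq _ _ c0).
- exact/nonneg_scale.
- exact/slackE.
- exact/feasible_scale_ineq.
- exact/(nonneg_scale _ c0).
- exact/slackE.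
Qed.

Lemma solution_scale_ineq c P x : 0 < c ->
  solution (scale_ineq c P) x <-> solution P x.
Proof.
move=> c0; split=> -[fx xmin]; split=> [|y fy].
- exact/(feasible_scale_ineq _ _ c0).
- exact/xmin/feasible_scale_ineq.
- exact/feasible_scale_ineq.
- exact/xmin/(feasible_scale_ineq _ _ c0).
Qed.

Lemma local_solution_scale_ineq c P x : 0 < c ->
  local_solution P x -> local_solution (scale_ineq c P) x.
Proof.
move=> c0 [fx xmin]; split; first exact/feasible_scale_ineq.
by apply: filterS xmin => y xmin fy; exact/xmin/(feasible_scale_ineq _ _ c0).
Qed.

End Scaling.

Section ChangeOfVariables.
Context {R : realType} {n : nat}.
Notation V := 'rV[R]_n.

Lemma jacobian_partial (psi : V -> V) y i k :
  differentiable psi y -> jacobian psi y i k = partial i psi y 0 k.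
Proof. by move=> dpsi; rewrite /partial deriveEjacobian// -rowE [RHS]mxE. Qed.

Lemma gradient_comp (f : V -> R) (psi : V -> V) y :
  differentiable psi y -> differentiable f (psi y) ->
  gradient (f \o psi) y = gradient f (psi y) *m (jacobian psi y)^T.
Proof.
move=> dpsi df; apply/rowP => i; rewrite !mxE partial_comp//.
by apply: eq_bigr => k _; rewrite mxE [in RHS]mxE jacobian_partial// mulrC.
Qed.

(** The second derivatives of [psi] enter the Hessian of [f \o psi] only
    through products with the first derivatives of [f], which vanish here. *)
Lemma hessian_comp (U W : set V) (f : V -> R) (psi : V -> V) y :
  open U -> (forall z, U z -> W (psi z)) -> C2_on W f -> C2_on U psi -> U y ->
  gradient f (psi y) = 0 ->
  hessian (f \o psi) y
  = jacobian psi y *m hessian f (psi y) *m (jacobian psi y)^T.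
Proof.
move=> oU UW [Cf Cpf] [Cpsi Cppsi] Uy gf0.
have dpsi z : U z -> differentiable psi z by move=> /Cpsi[].
have df z : U z -> differentiable f (psi z) by move=> /UW/Cf[].
have dpf k z : U z -> differentiable (partial k f) (psi z).
  by move=> /UW/(Cpf k)[].
have := fun i k => jacobian_partial i k (dpsi y Uy).
move: (jacobian psi y) => J JE.
apply/matrixP => i j; rewrite !mxE.
pose a k (z : V) : R := partial j psi z 0 k.
have da k : differentiable (a k) y by have [] := C1_coord k oU (Cppsi j) Uy.
have db k : differentiable (partial k f \o psi) y.
  by apply: differentiable_comp; [exact: dpsi|exact: dpf].
have b0 k : (partial k f \o psi) y = 0.
  by have /rowP/(_ k) := gf0; rewrite !mxE.
have -> : partial i (partial j (f \o psi)) y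
    = partial i (\sum_k a k * (partial k f \o psi)) y.
  apply: near_eq_derive; apply: (open_near_eq oU _ Uy) => z /set_mem Uz.
  by rewrite fct_sumE partial_comp//; [exact: dpsi|exact: df].
rewrite partial_sum => [|k]; last exact: differentiableM.
apply: eq_bigr => k _; rewrite partialM// b0 mul0r addr0 partial_comp//;
  last 2 first.
- exact: dpsi.
- exact: dpf.
rewrite mulrC !mxE JE; congr (_ * _); apply: eq_bigr => l _.
by rewrite !mxE JE.
Qed.

(** The chain rule for [psi \o phi], which is the identity near [x], exhibits
    the Jacobian of [phi] as a one-sided inverse; for square matrices this is
    enough. *)
Lemma jacobian_unitmx (U : set V) (phi psi : V -> V) x :
  open U -> U x -> (forall z, U z -> psi (phi z) = z) ->
  differentiable phi x -> differentiable psi (phi x) ->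
  jacobian psi (phi x) \in unitmx.
Proof.
move=> oU Ux phiK dphi dpsi.
suff /mulmx1_unit[] : jacobian phi x *m jacobian psi (phi x) = 1%:M by [].
apply/row_matrixP => i; rewrite !rowE mulmxA mulmx1.
rewrite -!deriveEjacobian// deriveE// deriveE//.
rewrite -[LHS]/(('d psi (phi x) \o 'd phi x) _) -diff_comp//.
rewrite -deriveE; last exact: differentiable_comp.
rewrite -[RHS](derive_id x); apply: near_eq_derive.
by apply: (open_near_eq oU _ Ux) => z /set_mem/phiK.
Qed.

End ChangeOfVariables.

Section Transport.
Context {R : realType} {n m p : nat}.
Context (P : nlp R n m p) (x : 'rV[R]_n).
Context (U V : set 'rV[R]_n) (phi psi : 'rV[R]_n -> 'rV[R]_n).
Context (CP : C2_nlp P) (diffeo : C2_diffeo U V phi psi) (Ux : U x).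
Context (VP : forall y, V y -> Defs.dom P (psi y)).

Let J := jacobian psi (phi x).

Let oU : open U. Proof. by have [[]] := diffeo. Qed.
Let oV : open V. Proof. by have [[]] := diffeo. Qed.
Let phiK : psi (phi x) = x. Proof. by have [_ _ ->] := diffeo. Qed.
Let Vphix : V (phi x).
Proof. by have [_ [+ _ _] _ _ _] := diffeo; apply. Qed.
Let dpsi : differentiable psi (phi x).
Proof. by have [_ _ _ _ [/(_ _ Vphix)[]]] := diffeo. Qed.
Let Dx : Defs.dom P x. Proof. by rewrite -phiK; exact: VP. Qed.

Let J_unit : J \in unitmx.
Proof.
have [_ _ K [/(_ _ Ux)[dphi _] _] _] := diffeo.
exact: jacobian_unitmx oU Ux K dphi dpsi.
Qed.

Let gradient_transport (f : 'rV[R]_n -> R) : C2_on (Defs.dom P) f ->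
  gradient (f \o psi) (phi x) = gradient f x *m J^T.
Proof.
move=> [Cf _]; rewrite gradient_comp// phiK//.
by have [] := Cf x Dx.
Qed.

Let dot_transport (f : 'rV[R]_n -> R) d : C2_on (Defs.dom P) f ->
  dot (gradient (f \o psi) (phi x)) d = dot (gradient f x) (d *m J).
Proof.
by move=> Cf; rewrite gradient_transport// /dot trmx_mul mulmxA.
Qed.

Lemma active_transport : active (transport V psi P) (phi x) = active P x.
Proof. by apply/setP => i; rewrite !inE/= phiK. Qed.

Lemma C2_transport : C2_nlp (transport V psi P).
Proof.
have [_ Cf Cg Ch] := CP; have [_ _ _ _ Cpsi] := diffeo.
split; first exact: oV.
- exact: C2_comp oV VP Cf Cpsi.
- move=> i; exact: C2_comp oV VP (Cg i) Cpsi.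
- move=> j; exact: C2_comp oV VP (Ch j) Cpsi.
Qed.

Lemma kkt_transport lam mu :
  kkt_triple P x lam mu -> kkt_triple (transport V psi P) (phi x) lam mu.
Proof.
move=> [gL [_ gx hx] lam0 slack]; split => //.
- rewrite -[lagrangian _ _ _]/(lagrangian P lam mu \o psi).
  by rewrite (gradient_transport (C2_lagrangian lam mu CP)) gL mul0mx.
- by split => //= k; rewrite phiK.
- by move=> i /=; rewrite phiK.
Qed.

(** Right multiplication by the transpose of [J] is injective and maps the
    gradients of [P] to those of the transported problem. *)
Lemma LICQ_transport : LICQ P x -> LICQ (transport V psi P) (phi x).
Proof.
have [_ _ Cg Ch] := CP.
pose f := linfun (mulmxr J^T : 'rV[R]_n -> 'rV[R]_n).
have kf : lker f == 0%VS.
  apply/lker0P => u v; rewrite !lfunE/= => uv.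
  by apply: (can_inj (mulmxK (_ : J^T \in unitmx))) uv; rewrite unitmx_tr.
move=> /(free_lker0 kf); rewrite /LICQ active_transport map_cat -!(map_comp f).
congr (is_true (free (_ ++ _))); apply: eq_map => k /=;
  by rewrite lfunE/= gradient_transport.
Qed.

(** [d *m J] is a critical direction of [P] whenever [d] is one of the
    transported problem, and both have the same curvature. *)
Lemma SOSC_transport lam mu : kkt_triple P x lam mu ->
  SOSC P x lam mu -> SOSC (transport V psi P) (phi x) lam mu.
Proof.
have [_ Cf Cg Ch] := CP; have [_ _ _ _ Cpsi] := diffeo.
have CL := C2_lagrangian lam mu CP.
move=> [gL _ _ _] sosc d d0 dg dl dh.
rewrite -[lagrangian _ _ _]/(lagrangian P lam mu \o psi).
rewrite (hessian_comp oV VP CL Cpsi Vphix) phiK//.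
have -> : dot (d *m (J *m hessian (lagrangian P lam mu) x *m J^T)) d
    = dot (d *m J *m hessian (lagrangian P lam mu) x) (d *m J).
  by rewrite /dot trmx_mul !mulmxA.
apply: sosc => [|i ia|i li|j].
- apply: contraNneq d0 => dJ.
  by rewrite -(mulmxK J_unit d) dJ mul0mx.
- by rewrite -(dot_transport _ (Cg i)); apply: dg; rewrite active_transport.
- by rewrite -(dot_transport _ (Cg i)); exact: dl.
- by rewrite -(dot_transport _ (Ch j)); exact: dh.
Qed.

End Transport.

(** * Invariance of the regime label *)

Theorem theorem3 (R : realType) (n m p : nat) (delta theta gamma : R) (k : nat)
  (hdelta : 0 < delta < 1 / 2) (htheta : 1 / 2 < theta < 1)
  (hgamma : 0 < gamma < 1) (hk : (1 <= k <= m - 1)%N) :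
  [/\
    (* (i) permutation invariance *)
    forall lam : 'rV[R]_m, nonneg lam ->
      forall s : 'S_m,
        Psi delta theta gamma k (\row_i lam 0 (s i)) =
        Psi delta theta gamma k lam,
    (* (ii) uniform multiplier rescaling *)
    forall lam : 'rV[R]_m, nonneg lam ->
      forall c : R, 0 < c ->
        [/\ Sigma k (c *: lam) = Sigma k lam,
            sigma delta (c *: lam) = sigma delta lam,
            tau (c *: lam) = tau lam,
            load (c *: lam) = c * load lam
          & same_side delta (load lam) (load (c *: lam)) ->
            Psi delta theta gamma k (c *: lam) = Psi delta theta gamma k lam],
    (* (iii) uniform constraint rescaling *)
    forall (f : 'rV[R]_n -> R) (g : 'I_m -> 'rV[R]_n -> R)
        (h : 'I_p -> 'rV[R]_n -> R)
        (x : 'rV[R]_n) (lam : 'rV[R]_m) (mu : 'rV[R]_p),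
      let P := NLP setT f g h in
      C2_nlp P -> kkt_triple P x lam mu -> LICQ P x -> SOSC P x lam mu ->
      forall c : R, 0 < c ->
        let P' := scale_ineq c P in
        [/\ local_solution P' x /\
              (forall y, solution P' y <-> solution P y),
            kkt_triple P' x (c^-1 *: lam) mu,
            forall lam' mu', kkt_triple P' x lam' mu' -> lam' = c^-1 *: lam
          & same_side delta (load lam / c) (load lam) ->
            Psi delta theta gamma k (c^-1 *: lam) = Psi delta theta gamma k lam]
    & (* (iv) diffeomorphism invariance *)
    forall (f : 'rV[R]_n -> R) (g : 'I_m -> 'rV[R]_n -> R)
        (h : 'I_p -> 'rV[R]_n -> R)
        (x : 'rV[R]_n) (lam : 'rV[R]_m) (mu : 'rV[R]_p)
        (U V : set 'rV[R]_n) (phi psi : 'rV[R]_n -> 'rV[R]_n),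
      let P := NLP setT f g h in
      C2_nlp P -> kkt_triple P x lam mu -> LICQ P x -> SOSC P x lam mu ->
      C2_diffeo U V phi psi -> U x ->
      let P' := transport V psi P in
      [/\ C2_nlp P', kkt_triple P' (phi x) lam mu,
          LICQ P' (phi x), SOSC P' (phi x) lam mu
        & forall lam' mu', kkt_triple P' (phi x) lam' mu' ->
            Psi delta theta gamma k lam' = Psi delta theta gamma k lam] ].
Proof.
split.
- by move=> lam _ s; exact: Psi_permute.
- move=> lam _ c c0; split.
  + exact: Sigma_scale.
  + exact: sigma_scale.
  + exact: tau_scale.
  + exact: load_scale.
  + exact: Psi_scale.
- move=> f g h x lam mu P CP kkt licq sosc c c0 P'.
  have cVc (l : 'rV[R]_m) : c *: (c^-1 *: l) = l.
    by rewrite scalerA mulfV ?scale1r// gt_eqF.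
  split.
  + split; last by move=> y; exact: solution_scale_ineq.
    apply: (local_solution_scale_ineq c0).
    exact: (@SOSC_local_solution _ _ _ _ P x lam mu erefl CP kkt sosc).
  + by apply/(kkt_scale_ineq _ _ _ _ c0); rewrite cVc.
  + move=> lam' mu' /(kkt_scale_ineq _ _ _ _ c0) kkt'.
    rewrite (kkt_unique CP licq kkt kkt') scalerA mulVf ?scale1r//.
    by rewrite gt_eqF.
  + rewrite mulrC -load_scale => side.
    by apply: Psi_scale; rewrite ?invr_gt0//; case: side => -[]; [left|right].
- move=> f g h x lam mu U V phi psi P CP kkt licq sosc diffeo Ux P'.
  have VP y : V y -> Defs.dom P (psi y) by move=> _.
  have CP' : C2_nlp P' := C2_transport CP diffeo VP.
  have kkt' : kkt_triple P' (phi x) lam mu := kkt_transport CP diffeo Ux VP kkt.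
  have licq' : LICQ P' (phi x) := LICQ_transport CP diffeo Ux VP licq.
  split; [exact: CP'|exact: kkt'|exact: licq'| |].
  + exact: (SOSC_transport CP diffeo Ux VP kkt sosc).
  + by move=> lam1 mu1 kkt1; rewrite (kkt_unique CP' licq' kkt1 kkt').
Qed.
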